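(* For every integer $n\ge 1$, the pyramid graph $Py(n)$ satisfies $$pa_2(Py(n))=si_2(Py(n))=\left\lceil\tfrac{2}{3}n\right\rceil\qquad\text{and}\qquad pa_3(Py(n))=si_3(Py(n))=\left\lceil\tfrac{1}{2}n\right\rceil .$$
   Context: Search model. Let $G$ be a finite directed acyclic (multi)graph with exactly one source. A sink is a vertex with no outgoing edge. A hidden set $E^*$ of edges contains exactly one outgoing edge of every non-sink vertex (and nothing else); following the edges of $E^*$ from the source yields a unique directed path $P(E^* )$ from the source to a sink. A question is a non-sink vertex $v$; its answer is the outgoing edge of $v$ that belongs to $E^*$. In each round up to $k$ questions are asked simultaneously; all answers of the round are then revealed, and later rounds may depend on the answers of earlier rounds. $pa_k(G)$ is the minimal number of rounds that suffices in the worst case (over all $E^*$, for a best deterministic strategy) to determine the path $P(E^* )$, and $si_k(G)$ is the minimal number of rounds that suffices in the worst case to determine the sink in which $P(E^* )$ ends. Pyramid graph $Py(n)$: its vertices lie on $n+1$ levels; for $1\le i\le n+1$ the $i$th level has the $i$ vertices $v_{i,1},\dots,v_{i,i}$. From every $v_{i,j}$ with $1\le i\le n$, $1\le j\le i$, there is one edge to $v_{i+1,j}$ and one edge to $v_{i+1,j+1}$, and there are no other edges. The source is $v_{1,1}$ and the sinks are the $n+1$ vertices of level $n+1$. *)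

(* Defs.v *)
From mathcomp Require Import all_boot.
Set Implicit Arguments.
Unset Strict Implicit.
Unset Printing Implicit Defensive.

(* Finite directed acyclic multigraphs with exactly one source. *)
Record dag := Dag {
  vertex : finType;
  edge : finType;
  src : edge -> vertex;
  tgt : edge -> vertex;
  source : vertex;
  dag_acyclic : forall c : seq edge,
    cycle (fun e f => tgt e == src f) c -> c = [::];
  dag_source : forall v : vertex, [forall e, tgt e != v] = (v == source)
}.

Section SearchModel.

Variable G : dag.
Implicit Types (v x : vertex G) (H : {set edge G}) (p : seq (edge G)).

Definition sink v : bool := [forall e : edge G, src e != v].

(* Edges never leave a sink, so this fixes H to consist of exactly one
   outgoing edge per non-sink vertex and nothing else. *)
Definition hidden_set H : bool :=
  [forall v, ~~ sink v ==> (#|[set e in H | src e == v]| == 1)].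

Fixpoint walk x p : bool :=
  if p is e :: p' then (src e == x) && walk (tgt e) p' else true.

Definition walk_end x p : vertex G := last x (map (@tgt G) p).

(* p is P(H), given as its list of edges; when H is a hidden set, exactly one
   p satisfies this (see hidden_path_ex and hidden_path_uniq). *)
Definition hidden_path H p : bool :=
  [&& walk (source G) p, all (mem H) p & sink (walk_end (source G) p)].

(* The history of a play is the list, oldest round first, of the sets of edges
   revealed in each round. A revealed edge names the question it answers. *)
Definition history := seq {set edge G}.

Record strategy (k : nat) := Strategy {
  ask :> history -> {set vertex G};
  ask_card : forall h, #|ask h| <= k;
  ask_nonsink : forall h v, v \in ask h -> ~~ sink v
}.

Definition answers H (Q : {set vertex G}) : {set edge G} :=
  [set e in H | src e \in Q].

Fixpoint transcript k (s : strategy k) H (t : nat) : history :=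
  if t is t'.+1 then
    let h := transcript s H t' in rcons h (answers H (s h))
  else [::].

Definition pa_suffices (k t : nat) : Prop :=
  exists (s : strategy k) (out : history -> seq (edge G)),
    forall H, hidden_set H -> hidden_path H (out (transcript s H t)).

Definition si_suffices (k t : nat) : Prop :=
  exists (s : strategy k) (out : history -> vertex G),
    forall H, hidden_set H ->
      exists2 p, hidden_path H p
               & walk_end (source G) p = out (transcript s H t).

Lemma hidden_path_ex H : hidden_set H -> exists p, hidden_path H p.
Proof.
move=> /forallP hH; pose nxt := fun e f : edge G => tgt e == src f.
have walkP x p : walk x p -> forall e, tgt e = x -> path nxt e p.
  elim: p x => //= f p IH x /andP[/eqP fx wp] e ex.
  by rewrite /nxt ex fx eqxx /=; apply: IH wp _ _.
have walkU x p : walk x p -> uniq p.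
  elim: p x => //= f p IH x /andP[_ wp]; rewrite (IH _ wp) andbT.
  apply/negP => fp; have := walkP _ _ wp f erefl.
  case/splitPr: fp => p1 p2; rewrite cat_path /= => /and3P[fp1 lf _].
  have /dag_acyclic// : cycle nxt (f :: p1).
  by rewrite /= rcons_path fp1.
have step m x : (exists2 p, walk x p && all (mem H) p & sink (walk_end x p)) \/
                (exists2 p, walk x p && all (mem H) p & size p = m).
  elim: m x => [|m IH] x; first by right; exists [::].
  have [sx|nsx] := boolP (sink x); first by left; exists [::].
  have := implyP (hH x) nsx; case/cards1P=> e /setP/(_ e).
  rewrite !inE eqxx => /andP[eH /eqP ex].
  case: (IH (tgt e)) => -[p /andP[wp pH] hp]; [left|right];
    by exists (e :: p); rewrite /= ?ex ?eqxx ?wp ?pH ?andbT ?hp.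
case: (step #|edge G|.+1 (source G)) => -[p /andP[wp pH] hp].
  by exists p; rewrite /hidden_path wp pH.
have := max_card (mem p); rewrite (card_uniqP (walkU _ _ wp)) hp.
by rewrite ltnn.
Qed.

Lemma hidden_path_uniq H p q :
  hidden_set H -> hidden_path H p -> hidden_path H q -> p = q.
Proof.
move=> /forallP hH; rewrite /hidden_path /walk_end.
elim: p (source G) q => [|e p IH] x [|f q] //=.
- by move=> sx /and3P[/andP[fx _] _ _]; have := forallP sx f; rewrite fx.
- by move=> /and3P[/andP[ex _] _ _] sx; have := forallP sx e; rewrite ex.
case/and3P=> /andP[ex wp] /andP[eH pH] sp.
case/and3P=> /andP[fx wq] /andP[fH qH] sq.
have ef : e = f.
  have nsx : ~~ sink x by apply/negP => /forallP/(_ e); rewrite ex.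
  case/cards1P: (implyP (hH x) nsx) => g /setP gE.
  have := gE e; have := gE f; rewrite !inE ex fx !andbT.
  by move: eH fH => /= -> -> /esym/eqP -> /esym/eqP ->.
by subst f; congr (_ :: _); apply: (IH (tgt e)); apply/and3P; split.
Qed.

End SearchModel.

Definition least (P : nat -> Prop) (t : nat) : Prop :=
  P t /\ forall t', P t' -> t <= t'.

(* [is_pa k G t] reads pa_k(G) = t, and likewise for si. *)
Definition is_pa (k : nat) (G : dag) : nat -> Prop := least (pa_suffices G k).
Definition is_si (k : nat) (G : dag) : nat -> Prop := least (si_suffices G k).

Section Pyramid.

Variable n : nat.

(* Indices start from 0: Tagged _ j at tag i is v_{i+1,j+1}. *)
Definition py_vertex : finType := {i : 'I_n.+1 & 'I_i.+1}.

(* The edge (Tagged _ j, b) at tag i goes from v_{i+1,j+1} to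
   v_{i+2,j+1} if b = false and to v_{i+2,j+2} if b = true. *)
Definition py_edge : finType := ({i : 'I_n & 'I_i.+1} * bool)%type.

Definition py_src (e : py_edge) : py_vertex :=
  let: (existT i j, _) := e in
  existT (fun i : 'I_n.+1 => 'I_i.+1) (widen_ord (leqnSn n) i) j.

Definition py_tgt (e : py_edge) : py_vertex :=
  let: (existT i j, b) := e in
  existT (fun i : 'I_n.+1 => 'I_i.+1) (lift ord0 i)
    (if b then lift ord0 j else widen_ord (leqnSn i.+1) j).

Definition py_source : py_vertex :=
  existT (fun i : 'I_n.+1 => 'I_i.+1) ord0 ord0.

Lemma py_vertex_eq (u v : py_vertex) :
  tag u = tag v :> nat -> tagged u = tagged v :> nat -> u = v.
Proof.
case: u v => i j [i' j'] /= /val_inj ii'; subst i' => /val_inj -> //.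
Qed.

Lemma py_acyclic (c : seq py_edge) :
  cycle (fun e f => py_tgt e == py_src f) c -> c = [::].
Proof.
pose lev (e : py_edge) : nat := tag e.1.
have next e f : py_tgt e == py_src f -> lev f = (lev e).+1.
  case: e f => [[i j] b] [[i' j'] b'] /eqP/(congr1 (fun v => val (tag v))) /=.
  by rewrite /lev /= => <-.
case: c => // e c /=; rewrite rcons_path => /andP[pc /next le].
have : lev e <= lev (last e c).
  elim: c e pc {le} => //= f c IH e /andP[/next ef /IH]; rewrite ef.
  exact: ltnW.
by rewrite le ltnn.
Qed.

Lemma py_source_uniq (v : py_vertex) :
  [forall e, py_tgt e != v] = (v == py_source).
Proof.
apply/forallP/eqP => [hv | -> [[i j] b]]; last first.
  by apply/eqP => /(congr1 (fun v => val (tag v))).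
have no_edge e : py_tgt e <> v by apply/eqP/hv.
case: v hv no_edge => -[[|i] lti] j _ no_edge.
  apply: py_vertex_eq => //=; by case: j {no_edge} => -[].
case: j no_edge => -[|j] ltj no_edge.
  case: (no_edge (existT _ (Ordinal (lti : i < n)) ord0, false)).
  exact: py_vertex_eq.
case: (no_edge (existT _ (Ordinal (lti : i < n))
         (Ordinal (ltj : j < i.+1)), true)).
exact: py_vertex_eq.
Qed.

Definition Py : dag := Dag py_acyclic py_source_uniq.

End Pyramid.

(* Main.v *)
(* Lower bound, 2n <= t(k+1) for every k: the adversary answers "left" at every
   vertex except possibly the first unasked vertex u of the path. In exchange
   for each round, 2 * level(u) plus the number of asked vertices below the
   level of u grows by at most k+1: asking u itself costs 2 and any other
   vertex costs 1. As long as u is not a sink, its two answers lead to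
   different sinks.

   Upper bounds: for k = 3, asking the current vertex and its two children
   gains two levels per round. For k = 2, two rounds gain three levels: first
   ask the current vertex u and the common child w of its two children, then
   the child of u on the path and its child other than w. *)

Require Import Defs.
From mathcomp Require Import all_boot all_order all_algebra.
From mathcomp Require Import zify lra.
Import GRing.Theory Num.Theory.
Local Open Scope ring_scope.

(** * Asked vertices and what a transcript reveals *)

Section Transcripts.

Set Implicit Arguments.
Unset Strict Implicit.
Unset Printing Implicit Defensive.
Local Open Scope nat_scope.
Variables (G : dag) (k : nat) (s : strategy G k).
Implicit Types (H : {set edge G}).

Definition asked H t : {set vertex G} :=
  \bigcup_(i < t) s (transcript s H i).

Lemma askedS H t : asked H t.+1 = asked H t :|: s (transcript s H t).
Proof. by rewrite /asked big_ord_recr. Qed.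

Lemma askedW H t v : v \in asked H t -> v \in asked H t.+1.
Proof. by rewrite askedS inE => ->. Qed.

Lemma sink_notin_asked H t v : sink v -> v \notin asked H t.
Proof.
by move=> sv; apply/bigcupP => -[i _ /ask_nonsink]; rewrite sv.
Qed.

Lemma size_transcript H t : size (transcript s H t) = t.
Proof. by elim: t => //= t IH; rewrite size_rcons IH. Qed.

(** Each round's questions depend only on earlier answers, so by induction an edge out of an unasked
    vertex cannot influence the play. This lets the adversary change such answers afterwards. *)
Lemma transcript_agree H H' t :
    (forall e, src e \in asked H t -> (e \in H) = (e \in H')) ->
  transcript s H t = transcript s H' t.
Proof.
elim: t => //= t IH agr.
rewrite -IH => [|e et]; last by apply: agr; apply: askedW.
congr rcons; apply/setP => e; rewrite !inE.
by case es: (src e \in _); rewrite ?andbF // !andbT agr // askedS inE es orbT.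
Qed.

Lemma asked_agree H H' t :
    (forall e, src e \in asked H t -> (e \in H) = (e \in H')) ->
  asked H t = asked H' t.
Proof.
elim: t => [|t IH] agr; first by rewrite /asked !big_ord0.
have agr' e : src e \in asked H t -> (e \in H) = (e \in H').
  by move=> et; apply: agr; apply: askedW.
by rewrite !askedS -(IH agr') -(transcript_agree agr').
Qed.

Lemma has_transcript H t e :
  has (fun A : {set edge G} => e \in A) (transcript s H t)
  = (e \in H) && (src e \in asked H t).
Proof.
elim: t => [|t IH] /=; first by rewrite /asked big_ord0 inE andbF.
by rewrite has_rcons IH askedS !inE -andb_orr orbC.
Qed.

End Transcripts.

Lemma pa_suffices_si G k t : pa_suffices G k t -> si_suffices G k t.
Proof.
case=> s [out hout]; exists s, (fun h => walk_end (source G) (out h)) => H hH.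
by exists (out (transcript s H t)) => //; apply: hout.
Qed.

(** * Hidden sets of the pyramid as Boolean functions on coordinates *)

Section Coordinates.

Set Implicit Arguments.
Unset Strict Implicit.
Unset Printing Implicit Defensive.
Local Open Scope nat_scope.
Variable n : nat.
Implicit Types (v : vertex (Py n)) (e f : edge (Py n)) (H : {set edge (Py n)}).
Implicit Types (g : nat * nat -> bool) (A B : {set vertex (Py n)}).

Definition coord v : nat * nat :=
  let v' : py_vertex n := v in (val (tag v'), val (tagged v')).

Lemma coord_inj : injective coord.
Proof. by move=> u v [tuv guv]; apply: py_vertex_eq. Qed.

Lemma coord_col v : (coord v).2 <= (coord v).1.
Proof. by case: v => i j /=; rewrite -ltnS. Qed.

Lemma coord_lev v : (coord v).1 <= n.
Proof. by case: v => i j /=; rewrite -ltnS. Qed.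

Definition right e : bool := let e' : py_edge n := e in e'.2.

Lemma coord_tgt e :
  coord (tgt e) = ((coord (src e)).1.+1, (coord (src e)).2 + right e).
Proof.
by case: e => -[i j] [] /=; rewrite /coord /= /bump /= ?add1n ?addn1 ?addn0.
Qed.

Lemma coord_src e : (coord (src e)).1 < n.
Proof. by case: e => -[i j] b /=. Qed.

Local Arguments src : simpl never.
Local Arguments tgt : simpl never.
Local Arguments coord : simpl never.

Lemma edge_inj e f :
  coord (src e) = coord (src f) -> right e = right f -> e = f.
Proof.
case: e f => [[i j] b] [[i' j'] b'] [/= ii' jj'] /= ->.
have ei : i = i' by apply: val_inj.
subst i'; congr (existT _ _ _, _); exact: val_inj.
Qed.

Lemma vertex_at l c : c <= l <= n -> exists v, coord v = (l, c).
Proof.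
case/andP=> cl ln.
by exists (existT (fun i : 'I_n.+1 => 'I_i.+1) (Ordinal (ln : l < n.+1))
            (Ordinal (cl : c < l.+1))).
Qed.

Lemma edge_at l c b :
  c <= l < n -> exists2 e, coord (src e) = (l, c) & right e = b.
Proof.
case/andP=> cl ln.
by exists (existT (fun i : 'I_n => 'I_i.+1) (Ordinal ln)
            (Ordinal (cl : c < l.+1)), b).
Qed.

Lemma sinkE v : sink v = (n <= (coord v).1).
Proof.
apply/forallP/idP => [hv | nv e].
  rewrite leqNgt; apply/negP => vn.
  have [|e esrc _] := @edge_at (coord v).1 (coord v).2 false.
    by rewrite coord_col.
  by have /eqP[] := hv e; apply: coord_inj; rewrite esrc; case: (coord v).
by apply: contraL nv => /eqP <-; rewrite -ltnNge coord_src.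
Qed.

(** A total function on pairs of naturals avoids dependent types; its values outside the non-sink
    vertices do not affect the set. *)
Definition hset g : {set edge (Py n)} :=
  [set e | right e == g (coord (src e))].

Lemma hidden_hset g : hidden_set (hset g).
Proof.
apply/forallP => v; apply/implyP; rewrite sinkE -ltnNge => vn.
have [|e esrc er] := @edge_at (coord v).1 (coord v).2 (g (coord v)).
  by rewrite coord_col.
have ev : src e = v by apply: coord_inj; rewrite esrc; case: (coord v).
apply/cards1P; exists e; apply/setP => f; rewrite !inE.
apply/andP/eqP => [[/eqP fr /eqP fv] | ->]; last by rewrite er ev !eqxx.
by apply: edge_inj; rewrite ?fr ?er fv ?ev.
Qed.

Lemma hidden_setE H : hidden_set H -> exists g, H = hset g.
Proof.
move=> /forallP hH.
exists (fun x => [exists e, [&& e \in H, coord (src e) == x & right e]]).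
apply/setP => e; rewrite inE.
have nse : ~~ sink (src e) by rewrite sinkE -ltnNge coord_src.
have /cards1P[f /setP Hf] := implyP (hH (src e)) nse.
have := Hf f; rewrite !inE eqxx => /andP[fH /eqP fe].
have Huniq e' : e' \in H -> src e' = src e -> e' = f.
  by move=> e'H e'e; apply/eqP; have := Hf e'; rewrite !inE e'H e'e eqxx => <-.
have -> : [exists e', [&& e' \in H, coord (src e') == coord (src e) & right e']]
    = right f.
  apply/existsP/idP => [[e' /and3P[e'H /eqP/coord_inj e'e]] | fr].
    by rewrite -(Huniq e').
  by exists f; rewrite fH fe eqxx.
apply/idP/eqP => [eH | er]; first by rewrite -(Huniq e).
have -> // : e = f by apply: edge_inj er; rewrite fe.
Qed.

(** The column of the hidden path on level [l], counted from 0; meaningful for [l <= n]. *)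
Fixpoint pos g l : nat := if l is l'.+1 then pos g l' + g (l', pos g l') else 0.

Lemma pos_le g l : pos g l <= l.
Proof. by elim: l => //= l IH; case: (g _); lia. Qed.

Lemma eq_pos g g' m :
    (forall l, l < m -> g (l, pos g l) = g' (l, pos g l)) ->
  forall l, l <= m -> pos g l = pos g' l.
Proof. by move=> gg' l; elim: l => //= l IH lm; rewrite -IH ?gg' //; apply: ltnW. Qed.

Lemma coord_source : coord (source (Py n)) = (0, 0).
Proof. by []. Qed.

Lemma walk_hset g p x l :
    walk x p -> all (mem (hset g)) p -> coord x = (l, pos g l) ->
  coord (walk_end x p) = (l + size p, pos g (l + size p)) /\
  forall e, e \in p -> exists l', coord (src e) = (l', pos g l').
Proof.
elim: p x l => [|e p IH] x l /=; first by rewrite addn0.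
move=> /andP[/eqP ex wp] /andP[eH pH] xl.
move: eH; rewrite inE ex xl => /eqP er.
have [|hend hmem] := IH (tgt e) l.+1 wp pH.
  by rewrite coord_tgt ex xl /= er.
rewrite addnS -addSn; split=> // f; rewrite inE => /orP[/eqP -> | /hmem //].
by exists l; rewrite ex xl.
Qed.

Lemma hidden_path_hset g p : hidden_path (hset g) p ->
  coord (walk_end (source (Py n)) p) = (n, pos g n) /\
  forall e, e \in p -> exists l, coord (src e) = (l, pos g l).
Proof.
case/and3P=> wp pH; rewrite sinkE.
have [hend hmem] := walk_hset (l := 0) wp pH coord_source.
rewrite add0n in hend; rewrite hend => /= np; split=> //.
have pn := coord_lev (walk_end (source (Py n)) p); rewrite hend in pn.
by have /eqP -> : size p == n by rewrite eqn_leq pn.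
Qed.

(** * The adversary argument *)

Section LowerBound.

Variables (k : nat) (s : strategy (Py n) k).

Definition unasked_at g t l :=
  forall v, coord v = (l, pos g l) -> v \notin asked s (hset g) t.

(** The comparison is of level numbers, which grow towards the sinks: these questions are spent on
    vertices that the path has yet to reach. *)
Definition above (A : {set vertex (Py n)}) l := #|[set v in A | l < (coord v).1]|.

Lemma aboveU A B l : above (A :|: B) l <= above A l + #|B|.
Proof.
rewrite /above; apply: leq_trans (_ : #|[set v in A | l < (coord v).1] :|: B| <= _).
  apply: subset_leq_card; apply/subsetP => v; rewrite !inE.
  by case/andP=> /orP[->|->] ->; rewrite ?orbT.
by rewrite cardsU leq_subr.
Qed.

Lemma above_mono A l m : l <= m -> above A m <= above A l.
Proof.
move=> lm; apply: subset_leq_card; apply/subsetP => v; rewrite !inE.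
by case: (_ \in _) => //=; apply: leq_trans.
Qed.

Lemma above_pair A l u v : u \in A -> v \in A -> u != v ->
  (coord u).1 = l.+1 -> (coord v).1 = l.+1 -> above A l.+1 + 2 <= above A l.
Proof.
move=> uA vA uv ul vl.
have -> : 2 = #|[set u; v]| by rewrite cards2 uv.
rewrite /above -cardsUI.
rewrite (_ : _ :&: _ = set0) ?cards0 ?addn0.
  apply: subset_leq_card; apply/subsetP => w; rewrite !inE.
  case/orP=> [/andP[-> /ltnW]|/orP[]/eqP ->] //; first by rewrite uA ul ltnSn.
  by rewrite vA vl ltnSn.
apply/setP => w; rewrite !inE.
by case: eqP => [->|_]; case: eqP => [->|_]; rewrite ?ul ?vl ?ltnn ?andbF.
Qed.

(** The adversary's alternative: the path goes right where it leaves level [l], and all other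
    answers stay. *)
Definition turn g l : nat * nat -> bool :=
  fun x => g x || (x == (l, pos g l)).

Lemma pos_turn g l m : m <= l -> pos (turn g l) m = pos g m.
Proof.
move=> ml; apply/esym/(@eq_pos _ _ l) => // i il; rewrite /turn.
by rewrite xpair_eqE (ltn_eqF il) orbF.
Qed.

Lemma pos_left g l m :
  (forall x, l <= x.1 -> g x = false) -> l <= m -> pos g m = pos g l.
Proof.
move=> gl; elim: m => [|m IH]; first by rewrite leqn0 => /eqP ->.
rewrite leq_eqVlt => /orP[/eqP -> //|lm] /=.
by rewrite gl // addn0 IH.
Qed.

Lemma turn_left g l : (forall x, l <= x.1 -> g x = false) ->
  forall x, l < x.1 -> turn g l x = false.
Proof.
move=> gl [m c] /= lm; rewrite /turn gl ?(ltnW lm) //=.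
by rewrite xpair_eqE gtn_eqF.
Qed.

Lemma pos_turn_left g l m : (forall x, l <= x.1 -> g x = false) -> l < m ->
  pos (turn g l) m = (pos g l).+1.
Proof.
move=> gl lm; rewrite (pos_left (turn_left gl) lm) /= pos_turn //.
by rewrite /turn eqxx orbT addn1.
Qed.

Lemma turn_agree g t l : unasked_at g t l ->
  forall e, src e \in asked s (hset g) t ->
    (e \in hset g) = (e \in hset (turn g l)).
Proof.
move=> una e easked; rewrite !inE /turn.
case: (coord (src e) =P (l, pos g l)) => [ea|_]; last by rewrite orbF.
by have := una _ ea; rewrite easked.
Qed.

(* While the adversary answers left everywhere from level [l] on, the two
   walks entered from [(l, pos g l)] run down columns [pos g l] and
   [(pos g l).+1] and never meet. When that vertex is asked, the adversary
   enters the walk that reaches an unasked vertex first: until then both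
   walks are asked, so each extra level descended is paid for by two asked
   vertices. *)
Lemma adversary t : exists g l,
  [/\ l <= n, forall x, l <= x.1 -> g x = false, unasked_at g t l
    & 2 * l + above (asked s (hset g) t) l <= t * k.+1].
Proof.
elim: t => [|t [g [l [ln gl una bound]]]].
  exists (fun=> false), 0; split=> //.
    by move=> v _; rewrite /asked big_ord0 inE.
  rewrite /above /asked big_ord0 (_ : finset _ = set0) ?cards0 //.
  by apply/setP => v; rewrite !inE.
have [|u uE] := @vertex_at l (pos g l); first by rewrite pos_le.
set A := asked s (hset g) t in bound.
set Q := s (transcript s (hset g) t).
pose AQ : {set vertex (Py n)} := A :|: Q.
have AS : asked s (hset g) t.+1 = AQ by rewrite askedS.
(* If [u] stays unasked, the level is kept and at most [k] new vertices are counted. *)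
have [uQ|uQ] := boolP (u \in Q); last first.
  exists g, l; split=> //.
    move=> v vE; rewrite AS /AQ inE negb_or una //=.
    by rewrite (coord_inj (etrans vE (esym uE))).
  rewrite AS; have : above AQ l <= above A l + #|Q| := aboveU A Q l.
  have := ask_card s (transcript s (hset g) t).
  by rewrite -/Q; lia.
(* The answer at [u] is seen only after this round, so both choices lead to the same asked set. *)
have turnE : asked s (hset (turn g l)) t.+1 = AQ.
  have agr := turn_agree una.
  by rewrite askedS -(asked_agree agr) -(transcript_agree agr).
(* [u] lies on level [l] itself and is not counted, so one of the [k] questions drops out. *)
have boundAQ : above AQ l <= above A l + k.-1.
  rewrite /AQ -(setD1K uQ) setUCA; apply: leq_trans (_ : above (A :|: Q :\ u) l <= _).
    apply: subset_leq_card; apply/subsetP => v; rewrite !inE.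
    by case: (v =P u) => [->|_]; [rewrite uE ltnn andbF | exact: id].
  apply: leq_trans (aboveU _ _ _) _; rewrite leq_add2l.
  have := ask_card s (transcript s (hset g) t); rewrite -/Q (cardsD1 u) uQ.
  by lia.
have lltn : l < n by have := ask_nonsink uQ; rewrite sinkE uE -ltnNge.
have k_gt0 : 0 < k.
  by apply: leq_trans (ask_card s (transcript s (hset g) t));
    apply/card_gt0P; exists u.
pose free i := [exists v : vertex (Py n), (v \notin AQ) &&
  ((coord v == (l + i.+1, pos g l)) || (coord v == (l + i.+1, (pos g l).+1)))].
(* Sinks are never asked, so the search for an unasked vertex ends at level [n] at the latest. *)
have exfree : exists i, free i.
  exists (n - l.+1); have [|v vE] := @vertex_at n (pos g l).
    by have := pos_le g l; lia.
  apply/existsP; exists v; rewrite -AS sink_notin_asked ?sinkE ?vE //=.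
  by rewrite (_ : l + _ = n) ?eqxx //; lia.
case: (ex_minnP exfree) => i /existsP[w /andP[wAQ wE]] imin.
have in_AQ j c : j < i -> c = pos g l \/ c = (pos g l).+1 ->
    exists2 v, v \in AQ & coord v = (l + j.+1, c).
  move=> ji hc.
  have win : l + i.+1 <= n by have := coord_lev w; case/orP: wE => /eqP ->.
  have [|v vE] := @vertex_at (l + j.+1) c; first by have := pos_le g l; lia.
  exists v => //; apply: contraLR ji => vAQ; rewrite -leqNgt; apply: imin.
  apply/existsP; exists v; rewrite vAQ vE.
  by case: hc => ->; rewrite eqxx ?orbT.
(* By minimality of [i], both columns are asked on every level passed, so each such level removes
   two vertices from the count. *)
have pay j : j <= i -> above AQ (l + j) + 2 * j <= above AQ l.
  elim: j => [|j IH] ji; first by rewrite addn0 muln0 addn0.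
  have [v1 v1A v1E] := in_AQ j _ ji (or_introl erefl).
  have [v2 v2A v2E] := in_AQ j _ ji (or_intror erefl).
  have := @above_pair AQ (l + j) v1 v2 v1A v2A.
  rewrite v1E v2E -addnS /=.
  have -> : v1 != v2.
    by apply/eqP => v12; move: v2E; rewrite -v12 v1E => -[]; lia.
  by move=> /(_ isT erefl erefl); have := IH (ltnW ji); lia.
(* [pay] covers [2 * i]; the remaining 2 for leaving [u], together with the [k.-1] of [boundAQ], is
   exactly one round's [k.+1]. *)
have final : 2 * (l + i.+1) + above AQ (l + i.+1) <= t.+1 * k.+1.
  have := pay i (leqnn i); have := @above_mono AQ (l + i) (l + i.+1).
  by rewrite leq_add2l leqnSn => /(_ isT); lia.
have lin : l + i.+1 <= n by have := coord_lev w; case/orP: wE => /eqP ->.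
have li : l < l + i.+1 by lia.
case/orP: wE => /eqP wE.
  exists g, (l + i.+1); split=> //; last by rewrite AS.
    by move=> x lx; apply: gl; lia.
  move=> v; rewrite (pos_left gl (ltnW li)) -wE => /coord_inj ->.
  by rewrite AS.
exists (turn g l), (l + i.+1); split=> //; last by rewrite turnE.
  by move=> x lx; apply: turn_left => //; lia.
by move=> v; rewrite pos_turn_left // -wE => /coord_inj ->; rewrite turnE.
Qed.

End LowerBound.

Lemma si_suffices_lower k t : si_suffices (Py n) k t -> 2 * n <= t * k.+1.
Proof.
case=> s [out hout].
have [g [l [ln gl una bound]]] := adversary s t.
rewrite leqNgt; apply/negP => tn; have lltn : l < n by lia.
have [p /hidden_path_hset[pend _]] := hout _ (hidden_hset g).
have [q /hidden_path_hset[qend _]] := hout _ (hidden_hset (turn g l)).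
rewrite -(transcript_agree (turn_agree una)) => <- => pq.
move: qend; rewrite -pq pend pos_turn_left // (pos_left gl ln).
by case; lia.
Qed.

(** * Strategies given by lists of coordinates *)

Section UpperBound.

(* Unasked vertices get the junk answer [false]. *)
Definition known (h : history (Py n)) : nat * nat -> bool := fun x =>
  [exists e : edge (Py n),
    [&& coord (src e) == x, right e & has (fun A : {set _} => e \in A) h]].

Lemma known_transcript k (s : strategy (Py n) k) g t v :
  v \in asked s (hset g) t ->
  known (transcript s (hset g) t) (coord v) = g (coord v).
Proof.
move=> va; apply/existsP/idP => [[e /and3P[/eqP <-]]|gv].
  by rewrite has_transcript inE => -> /andP[/eqP <-].
have vn : (coord v).1 < n.
  by rewrite ltnNge -sinkE; apply: contraL va; apply: sink_notin_asked.
have [|e esrc er] := @edge_at (coord v).1 (coord v).2 true.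
  by rewrite coord_col.
have ev : src e = v by apply: coord_inj; rewrite esrc; case: (coord v).
by exists e; rewrite has_transcript inE ev eqxx er gv va.
Qed.

Variables (k : nat) (want : history (Py n) -> seq (nat * nat)).
Hypothesis size_want : forall h, size (want h) <= k.

(** Coordinates on or past the sink level are dropped, so [want] needs no special case for the final
    round. *)
Definition wanted h : {set vertex (Py n)} :=
  [set v | ~~ sink v && (coord v \in want h)].

Lemma card_wanted h : #|wanted h| <= k.
Proof.
apply: leq_trans (size_want h); rewrite cardE -(size_map coord).
apply: uniq_leq_size; first by rewrite map_inj_uniq ?enum_uniq //; apply: coord_inj.
by move=> x /mapP[v]; rewrite mem_enum inE => /andP[_ vw] ->.
Qed.

Lemma wanted_nonsink h v : v \in wanted h -> ~~ sink v.
Proof. by rewrite inE => /andP[]. Qed.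

Definition seek := Strategy card_wanted wanted_nonsink.

(** The bound [l < n] lets [m] overshoot the sink level. *)
Definition explored g t m := forall l, l < m -> l < n ->
  forall v, coord v = (l, pos g l) -> v \in asked seek (hset g) t.

Lemma explored_pos g t m l : explored g t m -> l <= m -> l <= n ->
  pos (known (transcript seek (hset g) t)) l = pos g l.
Proof.
move=> ex lm ln; apply/esym/(@eq_pos _ _ l) => // i il.
have [|v vE] := @vertex_at i (pos g i); first by rewrite pos_le; lia.
by rewrite -vE known_transcript // (ex i) //; lia.
Qed.

Lemma exploredS g t m : explored g t m -> explored g t.+1 m.
Proof. by move=> ex l lm ln v vE; apply: askedW; apply: ex vE. Qed.

Lemma explored_succ g t m : explored g t m ->
    (m < n -> forall v, coord v = (m, pos g m) -> v \in asked seek (hset g) t) ->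
  explored g t m.+1.
Proof.
move=> ex exm l; rewrite ltnS leq_eqVlt => /orP[/eqP -> //|lm]; exact: ex.
Qed.

Lemma asked_want g t v x : coord v = x -> x.1 < n ->
  x \in want (transcript seek (hset g) t) -> v \in asked seek (hset g) t.+1.
Proof. by move=> <- xn xw; rewrite askedS !inE sinkE -ltnNge xn xw orbT. Qed.

Lemma explored_suffices t m :
  n <= m -> (forall g, explored g t m) -> pa_suffices (Py n) k t.
Proof.
move=> nm ex; exists seek.
(* The output is the path obtained by answering left wherever nothing is known. All vertices of the
   true path are asked, so the two paths coincide. *)
exists (fun h => xchoose (hidden_path_ex (hidden_hset (known h)))).
move=> _ /hidden_setE[g ->]; set h := transcript _ _ _.
have hp := xchooseP (hidden_path_ex (hidden_hset (known h))).
have [_ pE] := hidden_path_hset hp.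
case/and3P: hp => wp pH sp; apply/and3P; split=> //.
apply/allP => e ep; have := allP pH e ep; rewrite !inE.
have [l el] := pE e ep; have ln : l < n by have := coord_src e; rewrite el.
have lm : l < m by lia.
have elg : coord (src e) = (l, pos g l).
  by rewrite el (explored_pos (ex g)) ?(ltnW lm) ?(ltnW ln).
by rewrite known_transcript // (ex g l).
Qed.

End UpperBound.

(** * The strategies for three and two questions per round *)

Lemma pa3_suffices t : n <= 2 * t -> pa_suffices (Py n) 3 t.
Proof.
pose want (h : history (Py n)) := let l := 2 * size h in let c := pos (known h) l in
  [:: (l, c); (l.+1, c); (l.+1, c.+1)].
have size_want h : size (want h) <= 3 by [].
move=> nt; apply: (explored_suffices (size_want := size_want) nt) => g {nt}.
elim: t => [|t IH]; first by move=> l; rewrite ltn0.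
rewrite (_ : 2 * t.+1 = (2 * t).+2); last by lia.
have E l : l <= 2 * t -> l <= n -> _ := explored_pos IH.
have ask_c (l c : nat) : [|| (l, c) == (2 * t, pos g (2 * t)),
      (l, c) == ((2 * t).+1, pos g (2 * t)) |
      (l, c) == ((2 * t).+1, (pos g (2 * t)).+1)] ->
    2 * t <= l < n -> forall v, coord v = (l, c) ->
    v \in asked (seek size_want) (hset g) t.+1.
  move=> lc /andP[tl ln] v vE; have tn : 2 * t <= n by lia.
  by apply: (asked_want vE ln); rewrite /want size_transcript E // !inE.
apply: explored_succ; [apply: explored_succ (exploredS IH) _|] => ln v vE;
  apply: ask_c vE; rewrite ?ln ?andbT ?eqxx //=.
by case: (g _); rewrite ?addn1 ?addn0 eqxx ?orbT.
Qed.

Lemma pa2_suffices t : 2 * n <= 3 * t -> pa_suffices (Py n) 2 t.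
Proof.
pose want (h : history (Py n)) :=
  (* [(size h)./2] counts the completed blocks of two rounds, each worth three levels. In an odd
     round [c'] is [c] or [c.+1], and [c' + c' - c] is then [c] or [c.+2]: the column of the child
     of [(l.+1, c')] other than [(l.+2, c.+1)]. *)
  let l := 3 * (size h)./2 in let c := pos (known h) l in
  let c' := pos (known h) l.+1 in
  if odd (size h) then [:: (l.+1, c'); (l.+2, c' + c' - c)]
  else [:: (l, c); (l.+2, c.+1)].
have size_want h : size (want h) <= 2 by rewrite /want; case: ifP.
have odd_even g r : explored size_want g (2 * r) (3 * r) ->
    explored size_want g (2 * r).+1 (3 * r).+1 /\
    explored size_want g (2 * r).+2 (3 * r).+3.
  move=> ex.
  have sz : size (transcript (seek size_want) (hset g) (2 * r)) = 2 * r.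
    exact: size_transcript.
  have half0 : (2 * r)./2 = r by rewrite mul2n doubleK.
  have odd0 : odd (2 * r) = false by rewrite mul2n odd_double.
  have E l : l <= 3 * r -> l <= n -> _ := explored_pos ex.
  have w0 x : x = (3 * r, pos g (3 * r)) \/ x = ((3 * r).+2, (pos g (3 * r)).+1) ->
      3 * r <= n -> x \in want (transcript (seek size_want) (hset g) (2 * r)).
    by move=> hx rn; rewrite /want sz odd0 half0 E // !inE; case: hx => ->;
      rewrite eqxx ?orbT.
  have ex1 : explored size_want g (2 * r).+1 (3 * r).+1.
    apply: explored_succ (exploredS ex) _ => rn v vE.
    by apply: (asked_want vE rn); apply: w0; [left | exact: ltnW].
  split=> //.
  have sz1 : size (transcript (seek size_want) (hset g) (2 * r).+1) = (2 * r).+1.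
    exact: size_transcript.
  have half1 : (2 * r).+1./2 = r by rewrite mul2n -uphalfE uphalf_double.
  have odd1 : odd (2 * r).+1 = true by rewrite /= odd0.
  have E1 l : l <= (3 * r).+1 -> l <= n -> _ := explored_pos ex1.
  have ex2 : explored size_want g (2 * r).+2 (3 * r).+2.
    apply: explored_succ (exploredS ex1) _ => rn v vE; apply: (asked_want vE rn).
    by rewrite /want sz1 odd1 half1 E1 ?inE ?eqxx //; lia.
  apply: explored_succ ex2 _ => rn v vE.
  (* The path's vertex two levels down is either the common grandchild, asked in the first round of
     the block, or the other child, asked in the second. *)
  have [vc | vc] : coord v = ((3 * r).+2, (pos g (3 * r)).+1) \/
      coord v = ((3 * r).+2, pos g (3 * r).+1 + pos g (3 * r).+1 - pos g (3 * r)).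
    rewrite vE /=; case: (g _) => /=; case: (g _) => /=; [right|left|left|right];
      congr pair; lia.
  - by apply: askedW; apply: (asked_want vc rn); apply: w0; [right | lia].
  - apply: (asked_want vc rn).
    by rewrite /want sz1 odd1 half1 !E1 ?inE ?eqxx ?orbT //; lia.
have even g r : explored size_want g (2 * r) (3 * r).
  elim: r => [|r /odd_even[_]]; first by move=> l; rewrite ltn0.
  have -> : 2 * r.+1 = (2 * r).+2 by lia.
  by have -> : 3 * r.+1 = (3 * r).+3 by lia.
(* For [t = 2r + 1] the half block adds one level, and [2n <= 6r + 3] indeed gives [n <= 3r + 1]. *)
rewrite -(odd_double_half t) -mul2n; case: (odd t) => nt.
  apply: (explored_suffices (size_want := size_want) (m := (3 * t./2).+1)) => [|g].
    by lia.
  by have [] := odd_even g _ (even g t./2).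
apply: (explored_suffices (size_want := size_want) (m := 3 * t./2)) => [|g].
  by lia.
exact: even.
Qed.

End Coordinates.

(** * Ceilings as thresholds, and the conclusion *)

Lemma absz_ceil_le (x : rat) t : 0 <= x -> (`|Num.ceil x| <= t)%N = (x <= t%:R).
Proof.
move=> x0; have c0 : 0 <= Num.ceil x by rewrite ceil_ge0; lra.
by rewrite -lez_nat gez0_abs // ceil_le_int.
Qed.

Lemma least_threshold (P : nat -> Prop) c :
  (forall t, P t <-> (c <= t)%N) -> least P c.
Proof. by move=> Pc; split=> [|t /Pc //]; apply/Pc. Qed.

(** Knowing the path gives the sink, so an upper bound for paths and a lower bound for sinks settle
    both numbers. *)
Lemma is_pa_si k n c :
    (forall t, (c <= t)%N -> pa_suffices (Py n) k t) ->
    (forall t, (2 * n <= t * k.+1)%N -> (c <= t)%N) ->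
  is_pa k (Py n) c /\ is_si k (Py n) c.
Proof.
move=> upper lower; split; apply: least_threshold => t; split=> [|/upper //].
- by move=> /pa_suffices_si/si_suffices_lower/lower.
- by move=> /si_suffices_lower/lower.
- exact: pa_suffices_si.
Qed.

Theorem corollary4p5 (n : nat) (hn : (1 <= n)%N) :
  let c2 := `|Num.ceil (2 / 3 * n%:R : rat)|%N in
  let c3 := `|Num.ceil (1 / 2 * n%:R : rat)|%N in
  [/\ is_pa 2 (Py n) c2, is_si 2 (Py n) c2,
      is_pa 3 (Py n) c3 & is_si 3 (Py n) c3].
Proof.
move=> c2 c3.
have c2E t : (c2 <= t)%N = (2 * n <= 3 * t)%N.
  rewrite /c2 absz_ceil_le; last by rewrite mulr_ge0.
  by rewrite -(ler_nat rat) !natrM; apply/idP/idP; lra.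
have c3E t : (c3 <= t)%N = (n <= 2 * t)%N.
  rewrite /c3 absz_ceil_le; last by rewrite mulr_ge0.
  by rewrite -(ler_nat rat) !natrM; apply/idP/idP; lra.
have [|t|pa2 si2] := @is_pa_si 2 n c2.
- by move=> t; rewrite c2E; apply: pa2_suffices.
- by rewrite c2E; lia.
have [|t|pa3 si3] := @is_pa_si 3 n c3.
- by move=> t; rewrite c3E; apply: pa3_suffices.
- by rewrite c3E; lia.
by split.
Qed.
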